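(* Let the plant $$x_{k+1}=f(x_k,u_k,w),\qquad e_k=h(x_k,u_k,w)$$ with sampling period $T_{\rm s}>0$ satisfy Assumptions (A1)--(A3) stated in the context, with convex sets $\mathcal X,\mathcal U,\mathcal W$, equilibrium map $\pi_x$, and equilibrium input-to-error map $\pi(u,w)=h(\pi_x(u,w),u,w)\in\mathbb R^p$ for $(u,w)\in\mathcal U\times\mathcal W$. Let $\mathcal C\subseteq\mathcal U$ be a closed, non-empty, convex set, let $K\in\mathbb R^{m\times p}$, and let $\Gamma=\{\eta\in\mathbb R^p : K\eta\in\mathcal C\}$, a closed, non-empty, convex set. Suppose there exist a symmetric positive definite matrix $P\in\mathbb R^{p\times p}$ and constants $\mu,L>0$ such that $\eta\mapsto\pi(K\eta,w)$ is $\mu$-strongly monotone and $L$-Lipschitz continuous on $\Gamma$ with respect to $\langle\cdot,\cdot\rangle_P$, uniformly in $w\in\mathcal W$; that is, for all $w\in\mathcal W$ and all $\eta,\eta'\in\Gamma$, $$\langle \pi(K\eta,w)-\pi(K\eta',w),\,\eta-\eta'\rangle_P\ \ge\ \mu\,\|\eta-\eta'\|_P^2,$$ $$\|\pi(K\eta,w)-\pi(K\eta',w)\|_P\ \le\ L\,\|\eta-\eta'\|_P .$$ Define $T_{\rm i}^\star=\dfrac{T_{\rm s}L^2}{2\mu}$. Then for any $T_{\rm i}\in(T_{\rm i}^\star,\infty)$ there exists $\lambda^\star\in(0,1)$ such that for any $\lambda\in(0,\lambda^\star)$ and any $w\in\mathcal W$, the closed-loop system $$x_{k+1}=f(x_k,u_k,w),\qquad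 e_k=h(x_k,u_k,w),$$ $$\eta_{k+1}=(1-\lambda)\eta_k+\lambda\,\mathrm{Proj}_\Gamma^P\!\left(\eta_k-\tfrac{T_{\rm s}}{T_{\rm i}}e_k\right),\qquad u_k=K\eta_k,$$ possesses an exponentially stable equilibrium point $(\bar x,\bar\eta)\in\mathcal X\times\Gamma$, and the pair $(\bar e,\bar\eta)=(\pi(K\bar\eta,w),\bar\eta)$ satisfies $$\langle \bar e,\,\eta-\bar\eta\rangle_P\ \ge\ 0\qquad\text{for all }\eta\in\Gamma .$$
   Context: Notation. For a symmetric positive definite $P\in\mathbb R^{p\times p}$, $\langle x,y\rangle_P=x^{\mathsf T}Py$ and $\|x\|_P=\sqrt{x^{\mathsf T}Px}$. For a closed, non-empty, convex $\Gamma\subseteq\mathbb R^p$, $\mathrm{Proj}_\Gamma^P:\mathbb R^p\to\Gamma$ is $\mathrm{Proj}_\Gamma^P(\eta)=\operatorname{argmin}_{\nu\in\Gamma}\|\eta-\nu\|_P$. Plant. $x_k\in\mathbb R^n$ is the state, $u_k\in\mathbb R^m$ the control input, $w\in\mathbb R^{n_w}$ a constant exogenous signal (references and/or disturbances), and $e_k\in\mathbb R^p$, with $p\le m$, the error output; $f$ takes values in $\mathbb R^n$ and $h$ in $\mathbb R^p$. The controller state is $\eta_k\in\mathbb R^p$, initialized in $\Gamma$; the $\eta$-update maps $\Gamma$ into $\Gamma$, so $\eta_k\in\Gamma$ and $u_k=K\eta_k\in\mathcal C$ for all $k$. $T_{\rm i}>0$ is the integral time constant and $\lambda\in(0,1)$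 a damping parameter. Assumptions. There exist convex sets $\mathcal X\subseteq\mathbb R^n$, $\mathcal U\subseteq\mathbb R^m$, $\mathcal W\subseteq\mathbb R^{n_w}$ such that: (A1) $f$ and $h$ are continuous in all arguments on $\mathcal X\times\mathcal U\times\mathcal W$; $f$ is continuously differentiable with respect to $x$ and $u$; and $f$, $h$, $\partial f/\partial x$, $\partial f/\partial u$ are all Lipschitz continuous on $\mathcal X\times\mathcal U$, uniformly in $w\in\mathcal W$. (A2) There is a continuously differentiable map $\pi_x:\mathcal U\times\mathcal W\to\mathcal X$, Lipschitz continuous on $\mathcal U\times\mathcal W$, such that $\pi_x(u,w)=f(\pi_x(u,w),u,w)$ for all $(u,w)\in\mathcal U\times\mathcal W$. (A3) The equilibrium $\bar x=\pi_x(u,w)$ of $x_{k+1}=f(x_k,u,w)$ (with $u,w$ held constant) is exponentially stable, uniformly in $(u,w)\in\mathcal U\times\mathcal W$.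
   Formalization: Exponential stability is stated for initial states in X×Γ and for as long as the state stays in X; this is the usual notion if x̄ is interior to X, while for x̄ on the boundary of X the usual notion can fail. *)

(* Defs.v *)
From mathcomp Require Import all_boot all_order all_algebra.
From mathcomp Require Import all_classical all_reals all_analysis.

Set Implicit Arguments.
Unset Strict Implicit.
Unset Printing Implicit Defensive.

Import Order.TTheory GRing.Theory Num.Theory.
Import numFieldNormedType.Exports.

Local Open Scope classical_set_scope.
Local Open Scope ring_scope.

(* Vectors of R^n are columns 'cV[R]_n.  The ambient norm `|_| on R^n is the
   library's sup norm, and the max norm on products; convergence, Lipschitz
   continuity and exponential stability do not depend on this choice, because
   all the constants involved are existentially quantified. *)

Section WeightedGeometry.
Context {R : realType} {p : nat}.
Implicit Types (P : 'M[R]_p) (x y eta nu : 'cV[R]_p) (G : set 'cV[R]_p).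

Definition sym_posdef P : Prop :=
  P^T = P /\ forall x, x != 0 -> 0 < (x^T *m P *m x) 0 0.

Definition innerP P x y : R := (x^T *m P *m y) 0 0.

Definition normP P x : R := Num.sqrt (innerP P x x).

Definition is_argmin_dist P G eta nu : Prop :=
  G nu /\ forall nu', G nu' -> normP P (eta - nu) <= normP P (eta - nu').

(* [get] selects a minimiser; it is the unique one when P is positive definite
   and G is closed, convex and non-empty. *)
Definition projP P G eta : 'cV[R]_p := get [set nu | is_argmin_dist P G eta nu].

End WeightedGeometry.

Section ExponentialStability.
Context {R : realType} {V : normedModType R}.
Implicit Types (S T : set V) (F : V -> V) (zbar : V).

(* The bound is required for as long as the trajectory has not left S before
   time k.  For S = setT it is the usual bound for all initial states in a ball
   and all times. *)
Definition exp_bound S F zbar (c rho delta : R) : Prop :=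
  forall z0, S z0 -> `|z0 - zbar| < delta ->
  forall k, (forall j, (j < k)%N -> S (iter j F z0)) ->
    `|iter k F z0 - zbar| <= c * rho ^+ k * `|z0 - zbar|.

Definition exp_stable S F zbar : Prop :=
  [/\ S zbar, F zbar = zbar &
      exists c rho delta : R,
        [/\ 0 < c, 0 < rho < 1, 0 < delta & exp_bound S F zbar c rho delta]].

(* The restriction to S is immaterial when S is a neighbourhood of the
   equilibrium in an invariant set T: trajectories then never leave S, and
   stability holds for all initial states of T close to the equilibrium. *)
Lemma exp_stable_nbhs S T F zbar :
  S `<=` T -> within T (nbhs zbar) S -> (forall z, T z -> T (F z)) ->
  exp_stable S F zbar ->
  exists c rho delta : R,
    [/\ 0 < c, 0 < rho < 1, 0 < delta &
      forall z0, T z0 -> `|z0 - zbar| < delta ->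
      forall k, S (iter k F z0) /\
        `|iter k F z0 - zbar| <= c * rho ^+ k * `|z0 - zbar|].
Proof.
move=> ST /nbhs_normP[r /= r0 rS] TF [Sz Fz].
move=> [c [rho [delta [c0 /andP[rho0 rho1] d0 bnd]]]].
exists c, rho, (Num.min delta (Num.min r (r / c))).
split=> //; first by rewrite rho0.
  by rewrite !lt_min d0 r0 divr_gt0.
move=> z0 Tz0; rewrite !lt_min => /and3P[z0d z0r z0c] k.
have Titer j : T (iter j F z0) by elim: j => //= j; exact: TF.
have near_S z : T z -> `|z - zbar| < r -> S z.
  by move=> Tz zr; apply: rS => //=; rewrite distrC.
have Sz0 : S z0 by exact: near_S.
have Siter j : S (iter j F z0).
  elim/ltn_ind: j => j IH; apply: near_S => //.
  apply: (le_lt_trans (bnd _ Sz0 z0d _ IH)).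
  rewrite ltr_pdivlMr// mulrC in z0c; apply: le_lt_trans z0c.
  rewrite ler_wpM2r// ler_piMr ?(ltW c0)//.
  by apply: exprn_ile1; exact: ltW.
by split=> //; apply: bnd.
Qed.

End ExponentialStability.

Section Plant.
Context {R : realType} {n m nw p : nat}.
Variables (X : set 'cV[R]_n) (U : set 'cV[R]_m) (W : set 'cV[R]_nw).
Variables (f : 'cV[R]_n -> 'cV[R]_m -> 'cV[R]_nw -> 'cV[R]_n)
          (h : 'cV[R]_n -> 'cV[R]_m -> 'cV[R]_nw -> 'cV[R]_p)
          (pix : 'cV[R]_m -> 'cV[R]_nw -> 'cV[R]_n).

Definition dfx x u w : 'cV[R]_n -> 'cV[R]_n := 'd (fun x' => f x' u w) x.
Definition dfu x u w : 'cV[R]_m -> 'cV[R]_n := 'd (fun u' => f x u' w) u.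

(* Derivatives are linear maps between finite-dimensional spaces: continuity in
   operator norm is continuity of each directional value, and a Lipschitz bound
   L in operator norm is a bound L * `|v| on the value in direction v. *)
Definition assumptionA1 : Prop :=
  [/\ {within X `*` U `*` W, continuous (fun z => f z.1.1 z.1.2 z.2)} /\
      {within X `*` U `*` W, continuous (fun z => h z.1.1 z.1.2 z.2)},
      [/\ forall x u w, X x -> U u -> W w ->
            differentiable (fun x' => f x' u w) x /\
            differentiable (fun u' => f x u' w) u,
          forall v,
            {within X `*` U `*` W, continuous (fun z => dfx z.1.1 z.1.2 z.2 v)} &
          forall v,
            {within X `*` U `*` W, continuous (fun z => dfu z.1.1 z.1.2 z.2 v)}] &
      exists L : R, forall w, W w ->
        [/\ L.-lipschitz_(X `*` U) (fun z => f z.1 z.2 w),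
            L.-lipschitz_(X `*` U) (fun z => h z.1 z.2 w),
            forall v, (L * `|v|).-lipschitz_(X `*` U) (fun z => dfx z.1 z.2 w v) &
            forall v, (L * `|v|).-lipschitz_(X `*` U) (fun z => dfu z.1 z.2 w v)]].

(* pix only matters on U * W, so its derivative is taken relative to U * W. *)
Definition assumptionA2 : Prop :=
  [/\ forall u w, U u -> W w -> X (pix u w),
      exists D : 'cV[R]_m * 'cV[R]_nw ->
          {linear ('cV[R]_m * 'cV[R]_nw)%type -> 'cV[R]_n},
        (forall z, (U `*` W) z -> forall eps : R, 0 < eps ->
           \forall z' \near within (U `*` W) (nbhs z),
             `|pix z'.1 z'.2 - pix z.1 z.2 - D z (z' - z)| <= eps * `|z' - z|) /\
        (forall v, {within U `*` W, continuous (fun z => D z v)}),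
      exists L : R, L.-lipschitz_(U `*` W) (fun z => pix z.1 z.2) &
      forall u w, U u -> W w -> pix u w = f (pix u w) u w].

(* Stability in the whole state space R^n, with constants and size of the
   region of attraction independent of (u, w). *)
Definition assumptionA3 : Prop :=
  exists c rho delta : R,
    [/\ 0 < c, 0 < rho < 1, 0 < delta &
        forall u w, U u -> W w ->
          exp_bound setT (fun x => f x u w) (pix u w) c rho delta].

Definition pi_map (u : 'cV[R]_m) (w : 'cV[R]_nw) : 'cV[R]_p := h (pix u w) u w.

Definition closed_loop (K : 'M[R]_(m, p)) (P : 'M[R]_p) (G : set 'cV[R]_p)
    (Ts Ti lambda : R) (w : 'cV[R]_nw) (z : 'cV[R]_n * 'cV[R]_p) :
    'cV[R]_n * 'cV[R]_p :=
  let x := z.1 in let eta := z.2 in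
  let u := K *m eta in let e := h x u w in
  (f x u w,
   (1 - lambda) *: eta + lambda *: projP P G (eta - (Ts / Ti) *: e)).

End Plant.

Definition Gamma (R : realType) (m p : nat) (K : 'M[R]_(m, p))
  (C : set 'cV[R]_m) : set 'cV[R]_p := [set eta | C (K *m eta)].

(* Main.v *)
Require Import Defs.
From mathcomp Require Import all_boot all_order all_algebra.
From mathcomp Require Import all_classical all_reals all_analysis.
From mathcomp Require Import ring lra.

Import Order.TTheory GRing.Theory Num.Theory.
Import numFieldNormedType.Exports.

Local Open Scope classical_set_scope.
Local Open Scope ring_scope.

(** The map eta |-> Proj (eta - (Ts/Ti) pi(K eta, w)) is a contraction of Gamma in
    the P-norm, because Ts/Ti < 2 mu / L^2; its fixed point etabar is the
    equilibrium, and the variational characterization of the projection gives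
    the inequality.  For stability, write xi = x - pi_x(K eta, w).  Since [f] is
    only controlled on X, which trajectories with frozen input may leave, the
    plant is not compared with such trajectories but linearized at the
    equilibrium: the powers of A = df/dx inherit the bound c rho^k from (A3), and
    the mean value theorem on segments of X bounds f(x,u) - pi_x(u) - A xi by a
    small multiple of |xi| near the equilibrium.  A norm N adapted to A contracts
    xi up to a drift of order lambda, eta contracts at a rate proportional to
    lambda, and N(xi) + s |eta - etabar|_P decays for a suitable weight s as soon
    as lambda is below a threshold depending on the uniform constants only. *)

(** * Bilinearity of the weighted inner product *)

Section BilinearForm.
Context {R : realType} {p : nat} (P : 'M[R]_p).
Implicit Types x y z : 'cV[R]_p.

Lemma innerPDl x y z : innerP P (x + y) z = innerP P x z + innerP P y z.
Proof. by rewrite /innerP linearD/= !mulmxDl mxE. Qed.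

Lemma innerPDr x y z : innerP P z (x + y) = innerP P z x + innerP P z y.
Proof. by rewrite /innerP mulmxDr mxE. Qed.

Lemma innerPZl a x y : innerP P (a *: x) y = a * innerP P x y.
Proof. by rewrite /innerP linearZ/= -!scalemxAl mxE. Qed.

Lemma innerPZr a x y : innerP P x (a *: y) = a * innerP P x y.
Proof. by rewrite /innerP -scalemxAr mxE. Qed.

Lemma innerPNl x y : innerP P (- x) y = - innerP P x y.
Proof. by rewrite -scaleN1r innerPZl mulN1r. Qed.

Lemma innerPNr x y : innerP P x (- y) = - innerP P x y.
Proof. by rewrite -scaleN1r innerPZr mulN1r. Qed.

Lemma innerP0l x : innerP P 0 x = 0.
Proof. by rewrite -(scale0r 0) innerPZl mul0r. Qed.

Definition innerPE :=
  (innerPDl, innerPDr, innerPNl, innerPNr, innerPZl, innerPZr).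

End BilinearForm.

(** * The weighted norm and its equivalence with the sup norm *)

Section WeightedNorm.
Context {R : realType} {p : nat} {P : 'M[R]_p} (Ppos : sym_posdef P).
Implicit Types x y z : 'cV[R]_p.

Lemma innerPC x y : innerP P x y = innerP P y x.
Proof.
rewrite /innerP -[in LHS](trmxK (x^T *m P *m y)) mxE.
by rewrite !trmx_mul trmxK Ppos.1 mulmxA.
Qed.

Lemma innerP_gt0 x : x != 0 -> 0 < innerP P x x.
Proof. exact: Ppos.2. Qed.

Lemma innerP_ge0 x : 0 <= innerP P x x.
Proof.
have [->|/innerP_gt0/ltW//] := eqVneq x 0.
by rewrite innerP0l.
Qed.

Lemma normP_ge0 x : 0 <= normP P x. Proof. exact: sqrtr_ge0. Qed.

Lemma normP_sqr x : normP P x ^+ 2 = innerP P x x.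
Proof. by rewrite sqr_sqrtr// innerP_ge0. Qed.

Lemma normP0 : normP P 0 = 0.
Proof. by rewrite /normP innerP0l sqrtr0. Qed.

Lemma normP_eq0 x : normP P x = 0 -> x = 0.
Proof.
move=> x0; apply: contra_eq (normP_sqr x) => /innerP_gt0.
by rewrite x0 expr0n/= => /lt_eqF ->.
Qed.

Lemma normPZ a x : normP P (a *: x) = `|a| * normP P x.
Proof.
by rewrite /normP innerPZl innerPZr mulrA -expr2 sqrtrM ?sqr_ge0// sqrtr_sqr.
Qed.

Lemma normPN x : normP P (- x) = normP P x.
Proof. by rewrite -scaleN1r normPZ normrN normr1 mul1r. Qed.

(** Cauchy-Schwarz: with a and b the norms of x and y, the square of b x - a y equals 2 a b (a b -
    <x, y>) and is nonnegative. *)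
Lemma innerP_le_normP x y : innerP P x y <= normP P x * normP P y.
Proof.
have [->|x0] := eqVneq x 0; first by rewrite innerP0l normP0 mul0r.
have [->|y0] := eqVneq y 0; first by rewrite innerPC innerP0l normP0 mulr0.
have a0 : 0 < normP P x by rewrite sqrtr_gt0 innerP_gt0.
have b0 : 0 < normP P y by rewrite sqrtr_gt0 innerP_gt0.
have := innerP_ge0 (normP P y *: x - normP P x *: y).
rewrite !innerPE -!normP_sqr (innerPC y x).
set a := normP P x in a0 *; set b := normP P y in b0 *.
set i := innerP P x y => h.
have ab : 0 < a * b by rewrite mulr_gt0.
rewrite -subr_ge0 -(pmulr_rge0 _ ab).
by move: h; nra.
Qed.

Lemma ler_normPD x y : normP P (x + y) <= normP P x + normP P y.
Proof.
rewrite -(@ler_pXn2r _ 2)// ?nnegrE ?addr_ge0 ?normP_ge0//.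
rewrite normP_sqr !innerPE (innerPC y x) sqrrD !normP_sqr.
have := innerP_le_normP x y.
by rewrite mulr2n; lra.
Qed.

Lemma ler_normPB x y : normP P (x - y) <= normP P x + normP P y.
Proof. by rewrite -(normPN y) ler_normPD. Qed.

Lemma normP_distC x y : normP P (x - y) = normP P (y - x).
Proof. by rewrite -normPN opprB. Qed.

Lemma sym_posdef_unitmx : P \in unitmx.
Proof.
rewrite -row_free_unit -kermx_eq0; apply/rowV0P => v /sub_kermxP vP0.
apply/eqP; rewrite -trmx_eq0; apply: contraT => /innerP_gt0.
by rewrite /innerP trmxK vP0 mul0mx mxE ltxx.
Qed.

Lemma norm_cV_le (x : 'cV[R]_p) (c : R) :
  0 <= c -> (forall i, `|x i 0| <= c) -> `|x| <= c.
Proof.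
move=> c0 xc; rewrite [leLHS]/Num.Def.normr/= mx_normrE.
by apply: bigmax_le => // -[i j] _ /=; rewrite ord1.
Qed.

Lemma norm_coord_le {q r : nat} (x : 'M[R]_(q, r)) i j : `|x i j| <= `|x|.
Proof.
rewrite [leRHS]/Num.Def.normr/= mx_normrE.
exact: (le_bigmax _ (fun ij : 'I_q * 'I_r => `|x ij.1 ij.2|) (i, j)).
Qed.

(* x_i = <P^-1 e_i, x>_P, so that Cauchy-Schwarz bounds every coordinate. *)
Lemma norm_le_normP : exists2 c : R, 0 < c & forall x, `|x| <= c * normP P x.
Proof.
pose e i : 'cV[R]_p := invmx P *m delta_mx i 0.
exists (\sum_i normP P (e i) + 1).
  by rewrite ltr_wpDl// sumr_ge0// => i _; exact: normP_ge0.
move=> x; apply: norm_cV_le => [|i].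
  rewrite mulr_ge0 ?normP_ge0// addr_ge0// sumr_ge0// => i _.
  exact: normP_ge0.
have xi y : y i 0 = innerP P (e i) y.
  rewrite /innerP /e trmx_mul trmx_inv Ppos.1 mulmxKV ?sym_posdef_unitmx//.
  by rewrite trmx_delta -rowE mxE.
apply: (@le_trans _ _ (normP P (e i) * normP P x)).
  rewrite ler_norml xi innerP_le_normP andbT lerNl -innerPNr.
  by rewrite -(normPN x) innerP_le_normP.
rewrite ler_wpM2r ?normP_ge0// (bigD1 i)//= -addrA lerDl.
by rewrite addr_ge0// sumr_ge0// => j _; exact: normP_ge0.
Qed.

Lemma mulmx_norm_le {q r : nat} (A : 'M[R]_(q, r)) :
  exists2 c : R, 0 < c & forall x : 'cV[R]_r, `|A *m x| <= c * `|x|.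
Proof.
exists (\sum_i \sum_j `|A i j| + 1).
  by rewrite ltr_wpDl// sumr_ge0// => i _; exact: sumr_ge0.
move=> x; rewrite [leLHS]/Num.Def.normr/= mx_normrE.
apply: bigmax_le => [|[i j] _ /=].
  by rewrite mulr_ge0// addr_ge0// sumr_ge0// => i _; exact: sumr_ge0.
rewrite mxE (le_trans (ler_norm_sum _ _ _))//.
apply: (@le_trans _ _ ((\sum_k `|A i k|) * `|x|)).
  rewrite mulr_suml ler_sum// => k _.
  by rewrite normrM ler_wpM2l// norm_coord_le.
rewrite ler_wpM2r// (bigD1 i)//= -addrA lerDl addr_ge0// sumr_ge0// => k _.
exact: sumr_ge0.
Qed.

(** Expanding in the canonical basis leaves a triangle inequality; together with [norm_le_normP] it
    lets limits pass between the two norms. *)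
Lemma normP_le_norm : exists2 c : R, 0 < c & forall x, normP P x <= c * `|x|.
Proof.
pose e (j : 'I_p) : 'cV[R]_p := delta_mx j 0.
exists (\sum_i normP P (e i) + 1).
  by rewrite ltr_wpDl// sumr_ge0// => i _; exact: normP_ge0.
move=> x; have -> : normP P x = normP P (\sum_i x i 0 *: e i).
  congr (normP P _); apply/colP => i.
  rewrite summxE (bigD1 i)//= big1 => [|j ji].
    by rewrite !mxE !eqxx mulr1 addr0.
  by rewrite !mxE eq_sym (negbTE ji) mulr0.
rewrite mulrDl mul1r mulr_suml ler_wpDr//.
elim/big_ind2 : _ => [|x1 x2 y1 y2 h1 h2|i _]; first by rewrite normP0.
  exact: le_trans (ler_normPD _ _) (lerD h1 h2).
by rewrite normPZ mulrC ler_wpM2l ?normP_ge0// norm_coord_le.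
Qed.

End WeightedNorm.

(** * Geometric convergence and convex combinations *)

(** Geometric increments make the telescoping series absolutely convergent, and completeness gives a
    limit. *)
Lemma cvg_geometric_steps {R : realType} {m n : nat} {u : nat -> 'M[R]_(m, n)}
    {B q : R} :
  0 <= q < 1 -> (forall k, `|u k.+1 - u k| <= B * q ^+ k) -> cvgn u.
Proof.
move=> /andP[q0 q1] uB.
have ns : cvgn [normed series (telescope u)].
  apply: (@series_le_cvg R _ (geometric B q)) => //=.
  - by move=> k; exact: le_trans (uB k).
  - by apply: is_cvg_geometric_series; rewrite ger0_norm.
have cs : cvgn (series (telescope u)).
  move/cauchy_cvgP/cauchy_seriesP : ns => ns.
  apply/cauchy_cvgP/cauchy_seriesP => e /ns.
  apply: filterS => k /=; rewrite ger0_norm ?sumr_ge0//.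
  by apply: le_lt_trans; apply: ler_norm_sum.
suff -> : u = (fun=> u 0%N) \+ series (telescope u).
  by apply: is_cvgD => //; exact: is_cvg_cst.
by apply/funext => k /=; exact: eq_sum_telescope.
Qed.

(** Convexity with a plain real weight; [conv] packs the weight with its interval and gives it to
    its first argument, hence the swap of the points. *)
Lemma convex_setP {R : realType} {V : lmodType R} {A : set V} {x y} {t : R} :
  convex_set A -> A x -> A y -> 0 <= t <= 1 -> A ((1 - t) *: x + t *: y).
Proof.
move=> cA Ax Ay t01.
have [t0 t1] := andP t01.
have t01' : Itv.spec (Itv.num_sem (R := R)) (Itv.Real `[0%Z, 1%Z]) t.
  by rewrite /Itv.num_sem/= in_itv/= t0 t1 ger0_real.
have := cA y x (Itv.mk t01') (mem_set Ay) (mem_set Ax).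
by rewrite inE /conv/= addrC.
Qed.

(** * Projection onto a closed convex set, and fixed points, in the weighted norm *)

Section Projection.
Context {R : realType} {p : nat} {P : 'M[R]_p} (Ppos : sym_posdef P).
Context {G : set 'cV[R]_p} (Gclosed : closed G) (Gconv : convex_set G).
Context (G0 : G !=set0).
Implicit Types x y z : 'cV[R]_p.

(** Completeness is used in the sup norm, and norm equivalence carries the limit back. This serves
    both minimizing sequences and fixed-point iterations. *)
Lemma normP_geometric_steps (u : nat -> 'cV[R]_p) (B q : R) :
  0 <= q < 1 -> (forall k, G (u k)) ->
  (forall k, normP P (u k.+1 - u k) <= B * q ^+ k) ->
  exists2 l, G l &
    forall eps, 0 < eps -> \forall k \near \oo, normP P (u k - l) < eps.
Proof.
move=> q01 Gu uB.
have [c1 c10 Hc1] := norm_le_normP Ppos.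
have [c2 c20 Hc2] := normP_le_norm Ppos.
have cu : cvgn u.
  apply: (cvg_geometric_steps (B := c1 * B) q01) => k.
  by rewrite (le_trans (Hc1 _))// -mulrA ler_pM2l.
exists (limn u).
  by apply: closed_cvg cu => //; exact: nearW.
move=> eps eps0.
move/cvgrPdist_lt : cu => /(_ (eps / c2)); rewrite divr_gt0// => /(_ isT).
apply: filterS => k uk; rewrite normP_distC// (le_lt_trans (Hc2 _))//.
by rewrite mulrC -ltr_pdivlMr.
Qed.

Lemma parallelogram x y :
  normP P (x - y) ^+ 2 =
  2 * normP P x ^+ 2 + 2 * normP P y ^+ 2 - 4 * normP P (2^-1 *: (x + y)) ^+ 2.
Proof.
rewrite !normP_sqr// !innerPE (innerPC Ppos y x).
by field.
Qed.

(** A minimizing sequence converges: its midpoints stay in [G] by convexity, so they are no closer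
    to [y] than the infimum, and the parallelogram identity bounds consecutive increments. *)
Lemma is_argmin_dist_exists y : exists nu, is_argmin_dist P G y nu.
Proof.
pose D := [set normP P (y - nu) | nu in G].
have [g0 Gg0] := G0.
have D0 : has_inf D.
  split; first by exists (normP P (y - g0)), g0.
  by exists 0 => _ [nu _ <-]; exact: normP_ge0.
pose d := inf D.
have d0 : 0 <= d.
  apply: lb_le_inf; first exact: D0.1.
  by move=> _ [nu _ <-]; exact: normP_ge0.
have dle nu : G nu -> d <= normP P (y - nu).
  by move=> Gnu; apply: ge_inf; [exact: D0.2 | exists nu].
(* An excess of 4^-k in squared distance makes the increments at most twice 2^-k. *)
have /choice[u Hu] : forall k : nat, exists nu, G nu /\
    normP P (y - nu) ^+ 2 < d ^+ 2 + (2^-1 ^+ k) ^+ 2.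
  move=> k; have e0 : 0 < (2^-1 : R) ^+ k by rewrite exprn_gt0.
  have : d < Num.sqrt (d ^+ 2 + (2^-1 ^+ k) ^+ 2).
    rewrite -(@ltr_pXn2r _ 2)// ?nnegrE ?sqrtr_ge0//.
    by rewrite sqr_sqrtr ?addr_ge0 ?sqr_ge0// ltrDl exprn_gt0.
  move=> /(inf_lt D0.1)[_ [nu Gnu <-] nud]; exists nu; split => //.
  move: nud; rewrite -(@ltr_pXn2r _ 2)// ?nnegrE ?sqrtr_ge0 ?normP_ge0//.
  by rewrite (@sqr_sqrtr _ (d ^+ 2 + _))// addr_ge0 ?sqr_ge0.
have [] := @normP_geometric_steps u 2 2^-1.
- by apply/andP; split; lra.
- by move=> k; exact: (Hu k).1.
- move=> k; have e0 : 0 < (2^-1 : R) ^+ k by rewrite exprn_gt0.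
  rewrite -(@ler_pXn2r _ 2)// ?nnegrE ?normP_ge0 ?mulr_ge0 ?(ltW e0)//.
  have -> : u k.+1 - u k = (y - u k) - (y - u k.+1).
    by rewrite opprB [RHS]addrC subrKA.
  have := dle (2^-1 *: (u k + u k.+1)).
  have -> : y - 2^-1 *: (u k + u k.+1) = 2^-1 *: ((y - u k) + (y - u k.+1)).
    by apply/colP => i; rewrite !mxE; field.
  have Gm : G (2^-1 *: (u k + u k.+1)).
    rewrite scalerDr; have -> : (2^-1 : R) = 1 - 2^-1 by field.
    rewrite {2}(_ : 1 - 2^-1 = 2^-1 :> R); last by field.
    apply: (convex_setP Gconv (Hu _).1 (Hu _).1).
    by apply/andP; split; lra.
  move=> /(_ Gm) dm; have {}dm := lerXn2r 2 d0 (normP_ge0 _) dm.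
  rewrite parallelogram.
  have := (Hu k).2; have := (Hu k.+1).2; rewrite [2^-1 ^+ k.+1]exprS.
  move: dm e0; set e := 2^-1 ^+ k.
  set a := normP P _ ^+ 2; set b := normP P _ ^+ 2; set c := normP P _ ^+ 2.
  rewrite exprMn [(2 * e) ^+ 2]exprMn expr2 -[e ^+ 2]/(e * e).
  move=> dm e0 h1 h2; have := mulr_gt0 e0 e0.
  move: (e * e) h1 h2 dm => ee h1 h2 dm ee0; lra.
move=> l Gl ul; exists l; split => // nu Gnu.
apply/ler_addgt0Pr => eps eps0.
have e20 : 0 < eps / 2 by rewrite divr_gt0.
near \oo => k.
have ukl : normP P (u k - l) < eps / 2 by near: k; exact: ul.
have ek : 2^-1 ^+ k < eps / 2.
  near: k; have := @cvg_geometric R 1 2^-1; rewrite ger0_norm ?invr_ge0//.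
  rewrite invf_lt1 ?ltr1n// => /(_ isT)/cvgrPdist_lt/(_ _ e20).
  apply: filterS => k; rewrite sub0r normrN /geometric/= mul1r.
  by rewrite ger0_norm// exprn_ge0// invr_ge0.
have e0 : 0 < (2^-1 : R) ^+ k by rewrite exprn_gt0.
have := dle _ Gnu.
have -> : y - l = (y - u k) + (u k - l) by rewrite subrKA.
have := ler_normPD Ppos (y - u k) (u k - l).
suff : normP P (y - u k) <= d + 2^-1 ^+ k by lra.
rewrite -(@ler_pXn2r _ 2)// ?nnegrE ?normP_ge0 ?addr_ge0 ?(ltW e0)//.
rewrite (le_trans (ltW (Hu k).2))// sqrrD.
by rewrite lerD2r lerDl mulrn_wge0// mulr_ge0// ltW.
Unshelve. all: by end_near. Qed.

Lemma projP_argmin y : is_argmin_dist P G y (projP P G y).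
Proof. exact: (getPex (is_argmin_dist_exists y)). Qed.

Lemma projP_in y : G (projP P G y).
Proof. exact: (projP_argmin y).1. Qed.

(** If the product were some i > 0, moving from the projection towards [nu] by a fraction t would
    change the squared distance by - 2 t i + t^2 b, with b the squared norm of the direction: a
    decrease for small t. *)
Lemma projP_variational y nu : G nu ->
  innerP P (y - projP P G y) (nu - projP P G y) <= 0.
Proof.
have [Gx xmin] := projP_argmin y; set x := projP P G y in Gx xmin *.
move=> Gnu; rewrite leNgt; apply/negP => i0.
set i := innerP P _ _ in i0.
pose b := innerP P (nu - x) (nu - x).
have b0 : 0 <= b by exact: innerP_ge0.
(* The minimum with 1 keeps the moved point in [G]; the other bound gives t b < 2 i, and adding 1
   keeps the denominator positive. *)
pose t := Num.min 1 (i / (b + 1)).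
have t0 : 0 < t by rewrite lt_min ltr01 divr_gt0// ltr_wpDl.
have t1 : t <= 1 by rewrite ge_min lexx.
have tb : t * b < 2 * i.
  have h : t <= i / (b + 1) by rewrite ge_min lexx orbT.
  apply: (@le_lt_trans _ _ (i / (b + 1) * b)); first by rewrite ler_wpM2r.
  have b1 : 0 < b + 1 by rewrite ltr_wpDl.
  by rewrite mulrAC ltr_pdivrMr//; nra.
have t01 : 0 <= t <= 1 by rewrite (ltW t0).
have := xmin _ (convex_setP Gconv Gx Gnu t01).
have -> : y - ((1 - t) *: x + t *: nu) = (y - x) - t *: (nu - x).
  by apply/colP => j; rewrite !mxE; ring.
rewrite -(@ler_pXn2r _ 2)// ?nnegrE ?normP_ge0// !normP_sqr//.
move: t t0 tb {t1 t01} => t t0.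
rewrite -subr_gt0 => tb; have {tb} := mulr_gt0 t0 tb.
rewrite /i /b; move: (y - x) (nu - x) => v w tb.
rewrite !innerPE (innerPC Ppos w v).
by apply/negP; rewrite -ltNge; move: tb; lra.
Qed.

(** Each variational inequality is tested with the other projection; their sum bounds the squared
    distance of the projections by its product with y - z, and Cauchy-Schwarz concludes. *)
Lemma projP_nonexpansive y z :
  normP P (projP P G y - projP P G z) <= normP P (y - z).
Proof.
have hy := projP_variational y _ (projP_in z).
have hz := projP_variational z _ (projP_in y).
have := innerP_le_normP Ppos (y - z) (projP P G y - projP P G z).
have := normP_sqr Ppos (projP P G y - projP P G z).
move: hy hz; set a := projP P G y; set b := projP P G z.
have -> : y - z = (y - a) + (a - b) + (b - z) by rewrite !subrKA.
rewrite -(opprB a b) -(opprB z b); move: (y - a) (z - b) (a - b) => u v w.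
move=> hu hv hw.
have : innerP P w w <= innerP P (u + w - v) w.
  by move: hu hv; rewrite !innerPE; lra.
rewrite -hw => h1 h2; have := @normP_ge0 _ _ P w.
rewrite le_eqVlt => /predU1P[<-|w0]; first exact: normP_ge0.
by rewrite -(ler_pM2r w0) -expr2; exact: le_trans h1 h2.
Qed.

(** Banach's iteration, run in the norm where the map contracts: sup-norm distances need not
    shrink. *)
Lemma normP_fixpoint (T : 'cV[R]_p -> 'cV[R]_p) (q : R) :
  0 <= q < 1 -> (forall x, G x -> G (T x)) ->
  (forall x y, G x -> G y -> normP P (T x - T y) <= q * normP P (x - y)) ->
  exists2 x, G x & T x = x.
Proof.
move=> q01 TG Tq; have [g0 Gg0] := G0.
have Gu k : G (iter k T g0) by elim: k => //= k; exact: TG.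
have [] := @normP_geometric_steps (fun k => iter k T g0)
  (normP P (T g0 - g0)) q.
- by [].
- by [].
- elim=> [|k IH]; first by rewrite expr0 mulr1.
  rewrite exprS mulrCA; apply: le_trans (Tq _ _ (Gu k.+1) (Gu k)) _.
  by rewrite ler_wpM2l// (andP q01).1.
move=> l Gl ul; exists l => //; apply/eqP; rewrite -subr_eq0; apply/eqP.
apply: (normP_eq0 Ppos); apply: le_anti; rewrite normP_ge0 andbT.
apply/ler_addgt0Pr => eps eps0; rewrite add0r.
have e20 : 0 < eps / 2 by rewrite divr_gt0.
have [k _ ulk] := ul _ e20; have uk := ulk _ (leqnn k).
have /= uk1 := ulk _ (leqnSn k).
have -> : T l - l = (iter k.+1 T g0 - l) - (iter k.+1 T g0 - T l).
  by rewrite opprB [RHS]addrC subrKA.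
have := ler_normPB Ppos (iter k.+1 T g0 - l) (iter k.+1 T g0 - T l).
have := Tq _ _ (Gu k) Gl; have [q0 q1] := andP q01.
have := @normP_ge0 _ _ P (iter k T g0 - l).
rewrite /=; move: q0 q1 uk uk1.
set a := normP P (T l - l) => /=; set b := normP P (iter k T g0 - l) => /=.
by nra.
Qed.

End Projection.

(** * Lyapunov criteria for exponential stability *)

(** Two sets appear because [exp_bound] lets the state at time k lie outside [S]: the lower bound on
    [Ly] must hold there, while decay is only used inside [S]. An initial distance below r a / b
    keeps [Ly] below a r, hence the state within the radius r where [Ly] decays. *)
Lemma lyapunov_exp_stable {R : realType} {V : normedModType R} (S T : set V)
    (F : V -> V) (zbar : V) (Ly : V -> R) (a b q r : R) :
  S zbar -> F zbar = zbar -> S `<=` T -> (forall z, S z -> T (F z)) ->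
  0 < a -> 0 < b -> 0 < q < 1 -> 0 < r ->
  (forall z, T z -> a * `|z - zbar| <= Ly z) ->
  (forall z, S z -> Ly z <= b * `|z - zbar|) ->
  (forall z, S z -> `|z - zbar| < r -> Ly (F z) <= q * Ly z) ->
  exp_stable S F zbar.
Proof.
move=> Szbar Fzbar ST SFT a0 b0 /andP[q0 q1] r0 Lylb Lyub Lydec.
split => //; exists (b / a), q, (r * a / b).
split; [by rewrite divr_gt0|by rewrite q0|by rewrite divr_gt0 ?mulr_gt0|].
move=> z0 Sz0; rewrite ltr_pdivlMr// => z0r k.
have Tk j : (forall i, (i < j)%N -> S (iter i F z0)) -> T (iter j F z0).
  by case: j => [|j] Sj; [exact: ST | apply/SFT/Sj].
have near_of_Ly z c : T z -> 0 <= c <= 1 ->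
    Ly z <= c * Ly z0 -> `|z - zbar| < r.
  move=> Tz /andP[c0 c1] Lyz; rewrite -(ltr_pM2l a0).
  apply: le_lt_trans (Lylb _ Tz) _; apply: le_lt_trans Lyz _.
  have Ly0 : 0 <= Ly z0.
    by apply: le_trans (Lylb _ (ST _ Sz0)); rewrite mulr_ge0 ?(ltW a0).
  apply: (@le_lt_trans _ _ (Ly z0)); first by rewrite ler_piMl.
  apply: le_lt_trans (Lyub _ Sz0) _.
  by rewrite mulrC [ltRHS]mulrC.
have Lyk : (forall j, (j < k)%N -> S (iter j F z0)) ->
    Ly (iter k F z0) <= q ^+ k * Ly z0.
  elim: k => [|k IH] Sk; first by rewrite expr0 mul1r.
  have Sk' j : (j < k)%N -> S (iter j F z0) by move=> jk; exact/Sk/ltnW.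
  rewrite exprS -mulrA iterS; have {}IH := IH Sk'.
  apply: le_trans (Lydec _ (Sk _ (ltnSn _)) _) _; last by rewrite ler_pM2l.
  apply: near_of_Ly IH; first exact: Tk.
  by rewrite exprn_ge0 ?exprn_ile1 ?ltW.
move=> Sk; rewrite -(ler_pM2l a0); apply: le_trans (Lylb _ (Tk _ Sk)) _.
apply: le_trans (Lyk Sk) _.
rewrite (_ : a * _ = q ^+ k * (b * `|z0 - zbar|)).
  by rewrite ler_wpM2l ?Lyub// exprn_ge0 ?ltW.
by field; rewrite gt_eqF.
Qed.

(* The norm sum_(j < N) |A^j v| with c rho^N <= 1/2; its bounds depend on c and
   rho only, which keeps the threshold on lambda uniform in w. *)
Lemma power_bounded_lyapunov {R : realType} {V : normedModType R} (c rho : R) :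
  0 < c -> 0 < rho < 1 ->
  exists M beta : R, [/\ 0 < M, 0 < beta < 1 &
    forall A : {linear V -> V},
      (forall k v, `|iter k A v| <= c * rho ^+ k * `|v|) ->
      exists N : V -> R,
        [/\ forall v, `|v| <= N v, forall v, N v <= M * `|v|,
            forall u v, N (u + v) <= N u + N v &
            forall v, N (A v) <= (1 - beta) * N v]].
Proof.
move=> c0 /andP[rho0 rho1].
have [n crho] : exists n, c * rho ^+ n.+1 <= 2^-1.
  have := @cvg_geometric R c rho; rewrite gtr0_norm// => /(_ rho1).
  move=> /cvgrPdist_lt/(_ 2^-1); rewrite invr_gt0 ltr0n => /(_ isT)[n _ Hn].
  exists n; have := Hn n.+1 (leqnSn n).
  rewrite sub0r normrN /geometric/= => /ltW; apply: le_trans.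
  exact: ler_norm.
(* Each of the [n.+1] terms of the norm is at most c |v|; adding 1 ensures M >= 1, so that 1 / (2 M)
   < 1. *)
pose M := c * n.+1%:R + 1.
have M0 : 0 < M by rewrite ltr_wpDl// mulr_ge0// ltW.
have M1 : 1 <= M by rewrite lerDr mulr_ge0// ltW.
exists M, (2 * M)^-1; split => //.
  rewrite invr_gt0 mulr_gt0//= invf_lt1 ?mulr_gt0//; lra.
move=> A Ak; pose N v := \sum_(j < n.+1) `|iter j A v|.
have Nge v : `|v| <= N v by rewrite /N big_ord_recl/= lerDl sumr_ge0.
have Nle v : N v <= M * `|v|.
  rewrite /N /M mulrDl mul1r ler_wpDr//.
  rewrite (_ : c * _ * _ = \sum_(j < n.+1) (c * `|v|)).
    apply: ler_sum => j _; apply: le_trans (Ak _ _) _.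
    by rewrite ler_wpM2r// ler_piMr ?exprn_ile1 ?(ltW c0) ?(ltW rho0)
      ?(ltW rho1).
  by rewrite sumr_const card_ord -mulr_natr; ring.
exists N; split => //.
- move=> u v; rewrite /N -big_split/=; apply: ler_sum => j _.
  have -> : iter j A (u + v) = iter j A u + iter j A v.
    by elim: (nat_of_ord j) => //= k ->; rewrite linearD.
  exact: ler_normD.
(* Applying [A] shifts the sum: it loses |v| and gains at most |v| / 2, a net loss of at least N v /
   (2 M). *)
- move=> v; have -> : N (A v) = N v - `|v| + `|iter n.+1 A v|.
    rewrite /N big_ord_recr [in RHS]big_ord_recl/= -iterSr/=.
    rewrite [X in _ = X - _ + _]addrC addrK; congr (_ + _).
    by apply: eq_bigr => j _; rewrite -iterSr.
  have h : `|iter n.+1 A v| <= 2^-1 * `|v|.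
    by apply: le_trans (Ak _ _) _; rewrite ler_wpM2r.
  have : (2 * M)^-1 * N v <= 2^-1 * `|v|.
    by rewrite invfM -mulrA ler_pM2l ?invr_gt0// ler_pdivrMl.
  lra.
Qed.

(* [v] and [a] are the Lyapunov value and the norm of the fast plant deviation,
   [b] is the error of the slow controller state; primes are next-step values. *)
Lemma two_time_scale_decay {R : realFieldType} (beta gam C1 C2 C3 : R) :
  0 < beta < 1 -> 0 < gam -> 0 <= C1 -> 0 <= C2 -> 0 <= C3 ->
  exists s lamstar : R, [/\ 0 < s, 0 < lamstar < 1 &
    forall lam, 0 < lam < lamstar -> exists2 q, 0 < q < 1 &
      forall a b v b' v' : R, a <= v -> 0 <= v -> 0 <= b ->
        v' <= (1 - beta) * v + beta / 4 * a + lam * (C1 * a + C2 * b) ->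
        b' <= (1 - lam * gam) * b + lam * C3 * a ->
        v' + s * b' <= q * (v + s * b)].
Proof.
move=> /andP[beta0 beta1] gam0 C10 C20 C30.
(* With this weight s gam = 2 C2 + gam: half of the slow decay absorbs the coupling lam C2 b, the
   other half supplies a rate. *)
pose s := 2 * C2 / gam + 1.
have s0 : 0 < s by rewrite ltr_wpDl// divr_ge0 ?mulr_ge0// ltW.
have sgam : s * gam = 2 * C2 + gam by rewrite /s; field; rewrite gt_eqF.
have sC3 : 0 <= s * C3 by rewrite mulr_ge0// ltW.
have D0 : 0 < 4 * (C1 + s * C3 + 1) by lra.
(* Below this threshold lam (C1 + s C3) is at most beta / 4, so the fast value keeps a decay of beta
   / 2. *)
exists s, (beta / (4 * (C1 + s * C3 + 1))); split => //.
  by rewrite divr_gt0//= ltr_pdivrMr//; lra.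
move=> lam /andP[lam0]; rewrite ltr_pdivlMr// => lamlt.
pose d := Num.min (beta / 2) (lam * gam / 2).
have d0 : 0 < d by rewrite lt_min !divr_gt0// mulr_gt0.
have d1 : d <= beta / 2 by rewrite ge_min lexx.
have d2 : d <= lam * gam / 2 by rewrite ge_min lexx orbT.
exists (1 - d); first by apply/andP; split; lra.
move=> a b v b' v' av v0 b0 hv hb.
have hb' : s * b' <= s * ((1 - lam * gam) * b + lam * C3 * a).
  by rewrite ler_pM2l.
have k1 : beta / 4 * a <= beta / 4 * v by rewrite ler_pM2l// divr_gt0.
have k2 : lam * (C1 + s * C3) * a <= lam * (C1 + s * C3) * v.
  by rewrite ler_wpM2l// mulr_ge0 ?addr_ge0// ltW.
have k3 : lam * (C1 + s * C3) * v <= beta / 4 * v.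
  by rewrite ler_wpM2r//; lra.
have k4 : d * v <= beta / 2 * v by rewrite ler_wpM2r.
have k5 : s * d * b <= s * (lam * gam / 2) * b by rewrite ler_wpM2r// ler_pM2l.
have k6 : s * (lam * gam / 2) * b = lam * (C2 + gam / 2) * b.
  have -> : s * (lam * gam / 2) * b = lam * (s * gam) / 2 * b by field.
  by rewrite sgam; field.
have k7 : s * (lam * gam) * b = lam * (2 * C2 + gam) * b.
  by rewrite -sgam; ring.
have k8 : 0 <= lam * gam * b by rewrite !mulr_ge0// ltW.
move: hv hb' k1 k2 k3 k4 k5 k6 k7 k8; lra.
Qed.

(** * Linearization at an equilibrium and mean value estimates *)

Lemma iter_diff {R : realType} {V : normedModType R} (F : V -> V) (a : V) :
  F a = a -> differentiable F a -> forall k,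
  differentiable (iter k F) a /\ forall v, 'd (iter k F) a v = iter k ('d F a) v.
Proof.
move=> Fa dF; elim=> [|k [dk IH]].
  have e : iter 0 F = id :> (V -> V) by [].
  rewrite e; split => [|v]; first exact: ex_diff.
  by rewrite diff_val.
have ak : iter k F a = a by elim: k {dk IH} => //= k ->.
have e : iter k.+1 F = F \o iter k F by [].
have dF' : differentiable F (iter k F a) by rewrite ak.
rewrite e; split => [|v]; first exact: differentiable_comp.
by rewrite diff_comp//= ak IH.
Qed.

(* ['d F a]^k is the derivative at [a] of the k-th iterate of [F]. *)
Lemma exp_bound_linearization {R : realType} {V : normedModType R}
    (F : V -> V) (a : V) (c rho delta : R) :
  F a = a -> differentiable F a -> 0 < delta ->
  exp_bound setT F a c rho delta ->
  forall k v, `|iter k ('d F a) v| <= c * rho ^+ k * `|v|.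
Proof.
move=> Fa dF delta0 Fexp k v; have [dk <-] := iter_diff F a Fa dF k.
have ak : iter k F a = a by elim: k {dk} => //= k ->.
rewrite -deriveE//; have /diff_derivable dv := dk.
(* For small h the difference quotient inherits the exponential bound at a + h v; it lies in a
   closed ball, which therefore contains the derivative. *)
suff : closed_ball_ Num.Def.normr 0 (c * rho ^+ k * `|v|) ('D_v (iter k F) a).
  by rewrite /closed_ball_/= sub0r normrN.
have cl := @closed_closed_ball_ R V 0 (c * rho ^+ k * `|v|).
have cd : (fun h => h^-1 *: ((iter k F \o shift a) (h *: v) - iter k F a)) @ 0^'
  --> 'D_v (iter k F) a by exact: (dv v).
apply: (@closed_cvg _ _ _ _ _ _ cl _ _ cd).
have v0 : 0 < `|v| + 1 by rewrite ltr_wpDl.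
near=> h.
have h0 : h != 0 by near: h; exact: nbhs_dnbhs_neq.
have hv : `|h| < delta / (`|v| + 1).
  by near: h; apply: dnbhs0_lt; rewrite divr_gt0.
rewrite /closed_ball_/= sub0r normrN normrZ normfV ak.
rewrite ler_pdivrMl ?normr_gt0//.
have := Fexp (h *: v + a) I; rewrite addrK normrZ.
rewrite ltr_pdivlMr// mulrDr mulr1 in hv.
have hvd : `|h| * `|v| < delta by apply: le_lt_trans hv; rewrite lerDl.
move=> /(_ hvd k (fun _ _ => I)) /le_trans; apply.
by rewrite mulrCA.
Unshelve. all: by end_near. Qed.

(** The scalar mean value theorem applies to each coordinate along the segment; its intermediate
    point depends on the coordinate, which the sup norm tolerates. *)
Lemma diff_segment_le {R : realType} {n k : nat} (F : 'cV[R]_n -> 'cV[R]_k)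
    (a b : 'cV[R]_n) (D : 'cV[R]_k) (B : R) :
  0 <= B ->
  (forall t : R, 0 <= t <= 1 -> differentiable F (a + t *: (b - a))) ->
  (forall t : R, 0 <= t <= 1 -> `|'d F (a + t *: (b - a)) (b - a) - D| <= B) ->
  `|F b - F a - D| <= B.
Proof.
move=> B0 dF dB; apply: norm_cV_le => // i.
pose g (t : R) := F (a + t *: (b - a)) i 0.
have dg (t : R) : 0 <= t <= 1 ->
    is_derive t 1 g ('d F (a + t *: (b - a)) (b - a) i 0).
  move=> t01.
  have dl : is_diff t (cst a + *:%R ^~ (b - a)) (0 + *:%R ^~ (b - a)).
    exact: is_diffD.
  have dM : differentiable (F \o (cst a + *:%R ^~ (b - a))) t.
    by apply: differentiable_comp; [exact: ex_diff | exact: dF].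
  have gM : (fun s => (F \o (cst a + *:%R ^~ (b - a))) s i 0) = g by [].
  have derM : derivable (F \o (cst a + *:%R ^~ (b - a))) t 1.
    exact/diff_derivable.
  apply: DeriveDef.
    by rewrite -gM; exact: ((derivable_mxP _ _ _).1 derM i 0).
  rewrite -gM; have := derive_mx derM => /matrixP/(_ i 0).
  rewrite mxE => <-; rewrite deriveE// diff_comp/=; [|exact: ex_diff|exact: dF].
  by rewrite diff_val /= add0r scale1r.
have [||t t01 gt] := @MVT_segment R g
  (fun t => 'd F (a + t *: (b - a)) (b - a) i 0) 0 1 ler01.
- by move=> x /[!in_itv]/= /andP[x0 x1]; apply: dg; rewrite !ltW.
- apply: continuous_in_subspaceT => x; rewrite inE/= in_itv/= => x01.
  apply: differentiable_continuous; apply/derivable1_diffP.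
  by have [] := dg _ x01.
move: gt; rewrite /g scale1r scale0r addr0 subrKC subr0 mulr1 => gt.
have := dB t; rewrite in_itv/= in t01; move=> /(_ t01); apply: le_trans.
rewrite !mxE gt; have := norm_coord_le ('d F (a + t *: (b - a)) (b - a) - D) i 0.
by rewrite !mxE.
Qed.

(** * The constraint set as a linear preimage *)

Lemma closed_Gamma {R : realType} {m p : nat} (K : 'M[R]_(m, p))
    (C : set 'cV[R]_m) : closed C -> closed (Gamma K C).
Proof.
have cK : continuous (mulmx K : 'cV[R]_p -> 'cV[R]_m).
  have [k k0 Kk] := mulmx_norm_le K.
  apply/(@linear_bounded_continuous _ _ _ (mulmx K)%R)/linear_boundedP.
  exists k; split; [exact: gtr0_real | move=> r /ltW kr y].
  by apply: le_trans (Kk y) _; rewrite ler_wpM2r.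
by move=> clC; apply: (@preimage_closed _ _ (mulmx K)) clC => x _; exact: cK.
Qed.

Lemma convex_Gamma {R : realType} {m p : nat} (K : 'M[R]_(m, p))
    (C : set 'cV[R]_m) : convex_set C -> convex_set (Gamma K C).
Proof.
move=> cC x y t; rewrite !inE => Gx Gy.
have := cC _ _ t (mem_set Gx) (mem_set Gy).
by rewrite inE /Gamma/= /conv/= mulmxDr -!scalemxAr.
Qed.

(** * The relaxed projected gradient step *)

Section ProjectedGradient.
Context {R : realType} {p : nat} {P : 'M[R]_p} (Ppos : sym_posdef P).
Context {G : set 'cV[R]_p} (Gclosed : closed G) (Gconv : convex_set G).
Context (G0 : G !=set0).

(* The radicand may be negative when [G] is a singleton; the square root is then
   [0]. *)
Lemma gradient_step_contraction (pi : 'cV[R]_p -> 'cV[R]_p) (mu L al : R) :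
  0 <= al ->
  (forall x y, G x -> G y ->
    mu * normP P (x - y) ^+ 2 <= innerP P (pi x - pi y) (x - y)) ->
  (forall x y, G x -> G y -> normP P (pi x - pi y) <= L * normP P (x - y)) ->
  forall x y, G x -> G y ->
    normP P ((x - al *: pi x) - (y - al *: pi y)) <=
    Num.sqrt (1 - 2 * al * mu + al ^+ 2 * L ^+ 2) * normP P (x - y).
Proof.
move=> al0 mono lip x y Gx Gy.
have b0 : 0 <= normP P (x - y) by exact: normP_ge0.
rewrite -[leLHS]ger0_norm ?normP_ge0// -sqrtr_sqr.
rewrite -[X in _ <= _ * X]ger0_norm// -sqrtr_sqr mulrC -sqrtrM ?sqr_ge0//.
apply: ler_wsqrtr.
have -> : x - al *: pi x - (y - al *: pi y) = (x - y) - al *: (pi x - pi y).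
  by apply/colP => i; rewrite !mxE; ring.
have h1 := mono _ _ Gx Gy.
have := lip _ _ Gx Gy; rewrite -(@ler_pXn2r _ 2)// ?nnegrE ?normP_ge0//; last first.
  exact: le_trans (normP_ge0 _) (lip _ _ Gx Gy).
rewrite exprMn; move: h1; rewrite !normP_sqr//.
move: (x - y) (pi x - pi y) => v w h1 h2; rewrite !innerPE (innerPC Ppos v w).
have := ler_wpM2l al0 h1; have := ler_wpM2l (mulr_ge0 al0 al0) h2.
by rewrite !expr2; lra.
Qed.

(** Nonexpansiveness reduces both bounds to the unprojected step. In use, [e] is the measured error,
    [e0] and [eb] are the steady-state errors at [eta] and [etab], and [d] measures the plant
    transient. The first bound is the slow contraction; the second makes the motion of the plant
    equilibrium of order [lam]. *)
Lemma relaxed_projection_step (eta etab e e0 eb : 'cV[R]_p) (al kap lam d : R) :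
  0 <= al -> kap <= 1 -> 0 <= lam <= 1 ->
  projP P G (etab - al *: eb) = etab ->
  normP P ((eta - al *: e0) - (etab - al *: eb)) <= kap * normP P (eta - etab) ->
  normP P (e - e0) <= d ->
  let eta' := (1 - lam) *: eta + lam *: projP P G (eta - al *: e) in
  normP P (eta' - etab) <=
    (1 - lam * (1 - kap)) * normP P (eta - etab) + lam * (al * d) /\
  normP P (eta' - eta) <= lam * (2 * normP P (eta - etab) + al * d).
Proof.
move=> al0 kap1 /andP[lam0 lam1] fixb hk hd /=.
set y := projP P G (eta - al *: e).
have yb : normP P (y - etab) <= kap * normP P (eta - etab) + al * d.
  rewrite -{1}fixb; apply: le_trans (projP_nonexpansive Ppos Gclosed Gconv G0 _ _) _.
  have -> : eta - al *: e - (etab - al *: eb) =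
      (eta - al *: e0 - (etab - al *: eb)) - al *: (e - e0).
    by apply/colP => i; rewrite !mxE; ring.
  apply: le_trans (ler_normPB Ppos _ _) (lerD hk _).
  by rewrite normPZ ger0_norm// ler_wpM2l.
have b0 : 0 <= normP P (eta - etab) by exact: normP_ge0.
split.
  have -> : (1 - lam) *: eta + lam *: y - etab =
      (1 - lam) *: (eta - etab) + lam *: (y - etab).
    by apply/colP => i; rewrite !mxE; ring.
  apply: le_trans (ler_normPD Ppos _ _) _.
  rewrite !normPZ !ger0_norm ?subr_ge0//.
  have := ler_wpM2l lam0 yb; lra.
have -> : (1 - lam) *: eta + lam *: y - eta = lam *: ((y - etab) - (eta - etab)).
  by apply/colP => i; rewrite !mxE; ring.
rewrite normPZ ger0_norm// ler_wpM2l//.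
apply: le_trans (ler_normPB Ppos _ _) _.
have := ler_wpM2r b0 kap1; lra.
Qed.

End ProjectedGradient.

(** * Local accuracy of the linearized plant *)

(** The segment from [y] to [x] stays in [X] and within [D] of [xb], so along it the derivative at
    input [u] differs from the one at [(xb, ub)] by at most L D in operator norm. *)
Lemma linearization_error {R : realType} {n m : nat} (X : set 'cV[R]_n)
    (U : set 'cV[R]_m) (f : 'cV[R]_n -> 'cV[R]_m -> 'cV[R]_n) (L D : R)
    (x y xb : 'cV[R]_n) (u ub : 'cV[R]_m) :
  convex_set X -> 0 <= L ->
  (forall x u, X x -> U u -> differentiable (f ^~ u) x) ->
  (forall x x' u u' v, X x -> X x' -> U u -> U u' ->
    `|'d (f ^~ u) x v - 'd (f ^~ u') x' v| <=
    L * `|v| * Num.max `|x - x'| `|u - u'|) ->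
  X x -> X y -> X xb -> U u -> U ub ->
  `|x - xb| <= D -> `|y - xb| <= D -> `|u - ub| <= D ->
  `|f x u - f y u - 'd (f ^~ ub) xb (x - y)| <= L * `|x - y| * D.
Proof.
move=> cX L0 df lip Xx Xy Xxb Uu Uub xD yD uD.
have D0 : 0 <= D by exact: le_trans xD.
have Xt (t : R) : 0 <= t <= 1 -> X (y + t *: (x - y)).
  move=> t01; have := convex_setP cX Xy Xx t01.
  by rewrite scalerBl scale1r scalerBr addrAC addrA.
apply: (diff_segment_le (f ^~ u)).
- by rewrite !mulr_ge0.
- by move=> t t01; apply: df => //; exact: Xt.
- move=> t t01.
  apply: le_trans (lip _ _ _ _ _ (Xt _ t01) Xxb Uu Uub) _.
  rewrite ler_wpM2l ?mulr_ge0// ge_max uD andbT.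
  have -> : y + t *: (x - y) - xb = (1 - t) *: (y - xb) + t *: (x - xb).
    by apply/colP => i; rewrite !mxE; ring.
  have /andP[t0 t1] := t01.
  apply: le_trans (ler_normD _ _) _.
  rewrite !normrZ !ger0_norm ?subr_ge0//.
  have s0 : 0 <= 1 - t by rewrite subr_ge0.
  have := ler_wpM2l t0 xD; have := ler_wpM2l s0 yD; lra.
Qed.

(** Lipschitz constants obtained from existentials carry no sign, hence the absolute value. *)
Lemma lipschitz_bound {R : realType} {V W : normedModType R} {A : set V}
    {g : V -> W} {L : R} : L.-lipschitz_A g ->
  forall x y, A x -> A y -> `|g x - g y| <= `|L| * `|x - y|.
Proof.
move=> lip x y Ax Ay; apply: le_trans (lip (x, y) (conj Ax Ay)) _ => /=.
by rewrite ler_wpM2r// ler_norm.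
Qed.

(** * Equilibrium and stability of the closed loop *)

Theorem mainTheorem1 (R : realType) (n m nw p : nat)
  (X : set 'cV[R]_n) (U : set 'cV[R]_m) (W : set 'cV[R]_nw)
  (f : 'cV[R]_n -> 'cV[R]_m -> 'cV[R]_nw -> 'cV[R]_n)
  (h : 'cV[R]_n -> 'cV[R]_m -> 'cV[R]_nw -> 'cV[R]_p)
  (pix : 'cV[R]_m -> 'cV[R]_nw -> 'cV[R]_n)
  (C : set 'cV[R]_m) (K : 'M[R]_(m, p)) (P : 'M[R]_p) (Ts mu L : R) :
  (p <= m)%N -> 0 < Ts ->
  convex_set X -> convex_set U -> convex_set W ->
  assumptionA1 X U W f h ->
  assumptionA2 X U W f pix ->
  assumptionA3 U W f pix ->
  C `<=` U -> closed C -> C !=set0 -> convex_set C ->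
  Gamma K C !=set0 ->
  sym_posdef P -> 0 < mu -> 0 < L ->
  (forall w, W w -> forall eta eta', Gamma K C eta -> Gamma K C eta' ->
     innerP P (pi_map h pix (K *m eta) w - pi_map h pix (K *m eta') w)
              (eta - eta')
       >= mu * normP P (eta - eta') ^+ 2) ->
  (forall w, W w -> forall eta eta', Gamma K C eta -> Gamma K C eta' ->
     normP P (pi_map h pix (K *m eta) w - pi_map h pix (K *m eta') w)
       <= L * normP P (eta - eta')) ->
  forall Ti : R, Ts * L ^+ 2 / (2 * mu) < Ti ->
  exists lambdastar : R, 0 < lambdastar < 1 /\
  forall lambda : R, 0 < lambda < lambdastar ->
  forall w, W w ->
  exists (xbar : 'cV[R]_n) (etabar : 'cV[R]_p),
    [/\ X xbar /\ Gamma K C etabar,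
        exp_stable (X `*` Gamma K C)
          (closed_loop f h K P (Gamma K C) Ts Ti lambda w) (xbar, etabar),
        h xbar (K *m etabar) w = pi_map h pix (K *m etabar) w &
        forall eta, Gamma K C eta ->
          0 <= innerP P (pi_map h pix (K *m etabar) w) (eta - etabar)].
Proof.
move=> _ Ts0 cX cU cW [_ [dfxu _ _] [Lf0 LfP]] [pixX _ [Lp0 LpP] pixfix].
move=> [c [rho [delta [c0 rho01 delta0 A3]]]] CU clC C0 cC G0 Ppos mu0 L0.
move=> mono lip Ti TiL; set G := Gamma K C in G0 mono lip *.
have clG : closed G by exact: closed_Gamma.
have cG : convex_set G by exact: convex_Gamma.
have GU eta : G eta -> U (K *m eta) by move=> Geta; exact: CU.
have [c1 c10 Hc1] := norm_le_normP Ppos.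
have [c2 c20 Hc2] := normP_le_norm Ppos.
have [kK kK0 HkK] := mulmx_norm_le K.
have Ti0 : 0 < Ti.
  apply: le_lt_trans TiL.
  by rewrite divr_ge0 ?mulr_ge0 ?sqr_ge0// ?ltW// mulr_gt0.
pose al := Ts / Ti; have al0 : 0 < al by rewrite divr_gt0.
(* The lower bound on [Ti], in terms of the gradient step [al]; it brings the radicand of [kap]
   below 1. *)
have alL : al * L ^+ 2 < 2 * mu.
  by rewrite /al mulrAC ltr_pdivrMr// -ltr_pdivrMl ?mulr_gt0// mulrC.
pose kap := Num.sqrt (1 - 2 * al * mu + al ^+ 2 * L ^+ 2).
have kap0 : 0 <= kap by exact: sqrtr_ge0.
have kap1 : kap < 1.
  rewrite -(@ltr_pXn2r _ 2)// ?nnegrE// expr1n.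
  have : al * (al * L ^+ 2) < al * (2 * mu) by rewrite ltr_pM2l.
  rewrite /kap; case: (lerP 0 (1 - 2 * al * mu + al ^+ 2 * L ^+ 2)) => k0 ha.
    by rewrite sqr_sqrtr//; move: ha; rewrite !expr2; lra.
  by rewrite ltr0_sqrtr// expr0n.
pose Lf := `|Lf0|; have Lf_ge0 : 0 <= Lf by exact: normr_ge0.
pose Lp := `|Lp0|; have Lp_ge0 : 0 <= Lp by exact: normr_ge0.
have hL w x x' u : W w -> X x -> X x' -> U u ->
    `|h x u w - h x' u w| <= Lf * `|x - x'|.
  move=> Ww Xx Xx' Uu; have [_ hl _ _] := LfP w Ww.
  have := lipschitz_bound hl (x, u) (x', u) (conj Xx Uu) (conj Xx' Uu).
  by rewrite prod_normE/= subrr normr0 (max_l (normr_ge0 _)).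
have pL w eta eta' : W w -> G eta -> G eta' ->
    `|pix (K *m eta) w - pix (K *m eta') w| <= Lp * kK * `|eta - eta'|.
  move=> Ww Ge Ge'; have := lipschitz_bound LpP (K *m eta, w) (K *m eta', w)
    (conj (GU _ Ge) Ww) (conj (GU _ Ge') Ww).
  rewrite prod_normE/= subrr normr0 (max_l (normr_ge0 _)) => /le_trans; apply.
  by rewrite -mulrA ler_wpM2l// -mulmxBr.
(* [Cp] bounds the displacement of the plant equilibrium per unit of weighted norm of the controller
   state. *)
pose Cp := Lp * kK * c1.
have Cp0 : 0 <= Cp by rewrite !mulr_ge0// ltW.
have pLP w eta eta' : W w -> G eta -> G eta' ->
    `|pix (K *m eta) w - pix (K *m eta') w| <= Cp * normP P (eta - eta').
  move=> Ww Ge Ge'; apply: le_trans (pL _ _ _ Ww Ge Ge') _.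
  by rewrite /Cp -[leRHS]mulrA ler_wpM2l// mulr_ge0// ltW.
have [M [beta [M0 beta01 HN]]] :=
  @power_bounded_lyapunov R 'cV[R]_n c rho c0 rho01.
pose Ce := al * (c2 * Lf).
have Ce0 : 0 <= Ce.
  by apply: mulr_ge0; [|apply: mulr_ge0]; rewrite ?(ltW al0) ?(ltW c20).
have gam0 : 0 < 1 - kap by rewrite subr_gt0.
have MCp0 : 0 <= M * Cp by rewrite mulr_ge0// ltW.
have MCp20 : 0 <= M * Cp * 2 by rewrite mulr_ge0.
(* All constants are fixed before [w], so the threshold is uniform. The slow rate is lam (1 - kap),
   and the drift of the plant equilibrium contributes at most M Cp lam (2 b + Ce a). *)
have [s [lamstar [s0 lamstar01 Hdec]]] := two_time_scale_decay beta (1 - kap)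
  (M * Cp * Ce) (M * Cp * 2) Ce beta01 gam0 (mulr_ge0 MCp0 Ce0) MCp20 Ce0.
exists lamstar; split => // lam lam01 w Ww.
have [q q01 {}Hdec] := Hdec lam lam01.
have lam01' : 0 <= lam <= 1.
  by move: lam01 lamstar01 => /andP[? ?] /andP[? ?]; apply/andP; split; lra.
pose pi eta := pi_map h pix (K *m eta) w.
have contr := gradient_step_contraction Ppos pi mu L al (ltW al0)
  (mono w Ww) (lip w Ww).
have [etab Gb fixb] :
    exists2 etab, G etab & projP P G (etab - al *: pi etab) = etab.
  apply: (normP_fixpoint Ppos clG G0 _ kap).
  - by rewrite kap0.
  - by move=> eta _; exact: projP_in.
  - move=> x y Gx Gy; apply: le_trans (projP_nonexpansive Ppos clG cG G0 _ _) _.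
    exact: contr.
pose xb := pix (K *m etab) w.
have Xxb : X xb by apply: pixX => //; exact: GU.
exists xb, etab; split => //; last first.
  move=> eta Geta.
  (* At the fixed point the projection residual is - al pi(etab), and the positive factor [al]
     divides out. *)
  have := projP_variational Ppos clG cG G0 (etab - al *: pi etab) _ Geta.
  rewrite fixb addrAC subrr add0r innerPNl innerPZl oppr_le0.
  by rewrite pmulr_rge0.
have fixx : f xb (K *m etab) w = xb.
  by rewrite /xb -(pixfix _ _ (GU _ Gb) Ww).
have [dfb _] := dfxu _ _ _ Xxb (GU _ Gb) Ww.
have Apow := exp_bound_linearization _ _ _ _ _ fixx dfb delta0
  (A3 _ _ (GU _ Gb) Ww).
have [N [Nge Nle ND NA]] := HN _ Apow.
(* [E] times the distance to the equilibrium bounds the deviations of [x], of pi_x(K eta, w) and of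
   the input; [r] is such that M Lf E r is at most beta / 4. *)
pose E := 1 + Lp * kK + kK.
have LpkK0 : 0 <= Lp * kK by rewrite mulr_ge0// ltW.
have E0 : 0 < E by rewrite /E; lra.
pose r := beta / 4 / (M * Lf * E + 1).
have MLE0 : 0 <= M * Lf * E by rewrite !mulr_ge0// ltW.
have MLE1 : 0 < M * Lf * E + 1 by rewrite ltr_wpDl.
have [beta0 beta1] := andP beta01.
have r0 : 0 < r by rewrite !divr_gt0.
pose Ly (z : 'cV[R]_n * 'cV[R]_p) :=
  N (z.1 - pix (K *m z.2) w) + s * normP P (z.2 - etab).
(* The bounds |x - xb| <= N(x - pi_x) + Cp |eta - etab|_P and |eta - etab| <= c1 |eta - etab|_P
   dictate [a]; the reverse estimates dictate [b]. *)
pose a := Num.min 1 (s / (Cp + c1)).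
have Cpc1 : 0 < Cp + c1 by rewrite ltr_wpDl.
pose b := M + (M * Cp + s) * c2.
have step_in eta e : G eta ->
    G ((1 - lam) *: eta + lam *: projP P G (eta - al *: e)).
  by move=> Geta; apply: convex_setP => //; exact: projP_in.
(* One step may take the plant out of [X], but never the controller out of [G]. *)
apply: (lyapunov_exp_stable _ (setT `*` G) _ _ Ly a b q r) => //.
- by rewrite /closed_loop/= fixx -/(pi etab) fixb -scalerDl subrK scale1r.
- by move=> z [].
- by move=> [x eta] [_ Geta]; split => //; exact: step_in.
- by rewrite lt_min ltr01 divr_gt0.
- by rewrite /b ltr_wpDr// mulr_ge0 ?(ltW c20)// addr_ge0// ltW.
- move=> [x eta] [_ /= Geta]; rewrite /Ly/= prod_normE/=.
  have a1 : a <= 1 by rewrite ge_min lexx.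
  have a0 : 0 <= a by rewrite le_min ler01 divr_ge0 ?(ltW s0)// ltW.
  have as' : a * (Cp + c1) <= s.
    by rewrite -ler_pdivlMr// ge_min lexx orbT.
  have B0 := normP_ge0 (eta - etab) : 0 <= normP P (eta - etab).
  have asB := ler_wpM2r B0 as'.
  have N0 : 0 <= N (x - pix (K *m eta) w) by exact: le_trans (Nge _).
  have aN := ler_wpM2r N0 a1.
  apply: (@le_trans _ _ (a * (N (x - pix (K *m eta) w)
      + (Cp + c1) * normP P (eta - etab)))); last by lra.
  rewrite ler_wpM2l// ge_max; apply/andP; split.
    have -> : x - xb = (x - pix (K *m eta) w) + (pix (K *m eta) w - xb).
      by rewrite subrKA.
    apply: le_trans (ler_normD _ _) (lerD (Nge _) _).
    apply: le_trans (pLP _ _ _ Ww Geta Gb) _.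
    by rewrite ler_wpM2r// lerDl ltW.
  apply: le_trans (Hc1 _) _.
  have : 0 <= Cp * normP P (eta - etab) by rewrite mulr_ge0.
  by lra.
- move=> [x eta] [/= Xx Geta]; rewrite /Ly/= prod_normE/=.
  set z := Num.max _ _.
  have xz : `|x - xb| <= z by rewrite le_max lexx.
  have ez : `|eta - etab| <= z by rewrite le_max lexx orbT.
  have Bz : normP P (eta - etab) <= c2 * z.
    by apply: le_trans (Hc2 _) _; rewrite ler_pM2l.
  have h1 : `|x - pix (K *m eta) w| <= z + Cp * (c2 * z).
    have -> : x - pix (K *m eta) w = (x - xb) - (pix (K *m eta) w - xb).
      by rewrite opprB subrKA.
    apply: le_trans (ler_normB _ _) (lerD xz _).
    by apply: le_trans (pLP _ _ _ Ww Geta Gb) _; rewrite ler_wpM2l.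
  have h2 := ler_wpM2l (ltW M0) h1; have h3 := ler_wpM2l (ltW s0) Bz.
  have h4 := Nle (x - pix (K *m eta) w).
  rewrite /b; lra.
move=> [x eta] [/= Xx Geta]; rewrite prod_normE/= => zr.
set z := Num.max _ _ in zr.
have xz : `|x - xb| <= z by rewrite le_max lexx.
have ez : `|eta - etab| <= z by rewrite le_max lexx orbT.
have z0 : 0 <= z by exact: le_trans xz.
rewrite /Ly/= -/G.
set eta' := (1 - lam) *: eta + _.
have Geta' : G eta' by exact: step_in.
set y := pix (K *m eta) w.
have Xy : X y by apply: pixX => //; exact: GU.
set xi := x - y.
have ee : normP P (h x (K *m eta) w - pi eta) <= c2 * Lf * `|xi|.
  apply: le_trans (Hc2 _) _; rewrite -mulrA ler_pM2l//.
  by apply: hL => //; exact: GU.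
have [hb hd] := relaxed_projection_step Ppos clG cG G0 _ _ _ _ _ _ _ _ _
  (ltW al0) (ltW kap1) lam01' fixb (contr _ _ Geta Gb) ee.
apply: (Hdec `|xi|) => //.
- exact: le_trans (Nge _).
- exact: normP_ge0.
- have yz : `|y - xb| <= E * z.
    apply: le_trans (pL _ _ _ Ww Geta Gb) _.
    have := ler_wpM2l LpkK0 ez; have := mulr_ge0 (ltW kK0) z0.
    by rewrite /E; lra.
  have uz : `|K *m eta - K *m etab| <= E * z.
    rewrite -mulmxBr; apply: le_trans (HkK _) _.
    have := ler_wpM2l (ltW kK0) ez; have := mulr_ge0 LpkK0 z0.
    by rewrite /E; lra.
  have xz' : `|x - xb| <= E * z.
    apply: le_trans xz _; rewrite ler_peMl// /E; lra.
  have dL x1 x2 u1 u2 v : X x1 -> X x2 -> U u1 -> U u2 ->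
      `|'d (fun x => f x u1 w) x1 v - 'd (fun x => f x u2 w) x2 v| <=
      Lf * `|v| * Num.max `|x1 - x2| `|u1 - u2|.
    move=> Xx1 Xx2 Uu1 Uu2; have [_ _ dl _] := LfP w Ww.
    have := lipschitz_bound (dl v) (x1, u1) (x2, u2)
      (conj Xx1 Uu1) (conj Xx2 Uu2).
    by rewrite normrM normr_id prod_normE.
  have err := linearization_error X U (fun x u => f x u w) Lf (E * z) x y xb
    (K *m eta) (K *m etab) cX Lf_ge0
    (fun x u Xx Uu => (dfxu x u w Xx Uu Ww).1) dL Xx Xy Xxb
    (GU _ Geta) (GU _ Gb) xz' yz uz.
  have fy : f y (K *m eta) w = y by rewrite -(pixfix _ _ (GU _ Geta) Ww).
  rewrite /= fy -/xi in err.
  set A := 'd (fun x => f x (K *m etab) w) xb in err NA *.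
  (* Three terms: the linear part, contracted by [N]; the linearization error, whose [N] is at most
     beta / 4 |xi|; and the drift of the plant equilibrium, of order [lam]. *)
  have -> : f x (K *m eta) w - pix (K *m eta') w =
      A xi + ((f x (K *m eta) w - y - A xi) + (y - pix (K *m eta') w)).
    by rewrite addrA [A xi + _]addrC subrK subrKA.
  apply: le_trans (ND _ _) _; rewrite -[leRHS]addrA.
  apply: lerD; first exact: NA.
  apply: le_trans (ND _ _) _; apply: lerD.
    apply: le_trans (Nle _) _; apply: le_trans (ler_wpM2l (ltW M0) err) _.
    have -> : M * (Lf * `|xi| * (E * z)) = (M * Lf * E * z) * `|xi| by ring.
    rewrite ler_wpM2r//; apply: (@le_trans _ _ ((M * Lf * E + 1) * r)).
      by rewrite ler_pM// ?(ltW zr)// lerDl.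
    by rewrite /r mulrC divfK// gt_eqF.
  apply: le_trans (Nle _) _.
  apply: (@le_trans _ _ (M * Cp * normP P (eta' - eta))).
    by rewrite -mulrA ler_pM2l// normP_distC// pLP.
  have := ler_wpM2l MCp0 hd; rewrite /Ce; lra.
- by move: hb; rewrite /Ce; lra.
Qed.
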